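(* Let $T\in\mathcal{B}(\mathcal{H})$, $T\ne0$, be a normal operator whose spectrum $\sigma(T)$ is contained in a circular sector of the disk of radius $\|T\|$ centered at the origin with central angle less than $\pi$, i.e. there are $\varphi_0\in\mathbb{R}$ and $0\le\delta<\pi$ with $\sigma(T)\subseteq\{re^{i\varphi}:0\le r\le\|T\|,\ \varphi_0\le\varphi\le\varphi_0+\delta\}$. Then $T\in\mathcal{A}_\alpha$ for every $\alpha\in\mathbb{C}\setminus\{0\}$ such that $$\arg(\alpha)+\arg(\lambda)\in\left(-\frac\pi2,\frac\pi2\right)\quad\text{for all }\lambda\in\sigma(T)\setminus\{0\}$$ and $$|\alpha|\le\frac{2}{\|T\|}\inf_{\lambda\in\sigma(T)\setminus\{0\}}\cos(\arg(\alpha)+\arg(\lambda)).$$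
   Context: $\mathcal{H}$ is a separable nontrivial complex Hilbert space, $\mathcal{B}(\mathcal{H})$ is the algebra of bounded linear operators on $\mathcal{H}$ with the operator norm, and $I$ is the identity operator. For $\alpha\in\mathbb{C}\setminus\{0\}$, $\mathcal{A}_\alpha=\{T\in\mathcal{B}(\mathcal{H}):\|\alpha T-I\|\le1\}$. Arguments of non-zero complex numbers are understood modulo $2\pi$. *)

(* Defs.v *)
From HB Require Import structures.
From mathcomp Require Import all_boot all_order all_algebra.
From mathcomp Require Import complex.
From mathcomp Require Import all_classical all_reals all_analysis.
From mathcomp Require Import ring lra.

Set Implicit Arguments.
Unset Strict Implicit.
Unset Printing Implicit Defensive.

Import Order.TTheory GRing.Theory Num.Theory.
Import numFieldNormedType.Exports.

Local Open Scope classical_set_scope.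
Local Open Scope complex_scope.
Local Open Scope ring_scope.

HB.mixin Record CompleteNormedModule_isHilbert (R : realType) (H : Type)
    & CompleteNormedModule R[i] H := {
  inner : H -> H -> R[i];
  inner_linear : forall y : H, linear_for *%R (inner ^~ y);
  inner_conj : forall x y : H, inner y x = (inner x y)^*%R;
  inner_normE : forall x : H, inner x x = `|x| ^+ 2
}.

#[short(type="hilbertType")]
HB.structure Definition Hilbert (R : realType) :=
  {H of CompleteNormedModule R[i] H & CompleteNormedModule_isHilbert R H}.

Record bounded_operator (R : realType) (H : hilbertType R) := BoundedOperator {
  bop_fun :> {linear H -> H};
  bop_bounded : bounded_near bop_fun (nbhs (0 : H))
}.

Section RieszAdjoint.
Variables (R : realType) (H : hilbertType R).
Implicit Types (x y z u v : H).

Local Notation "''[' u , v ]" := (inner u v).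

Lemma innerDl x y z : '[x + y, z] = '[x, z] + '[y, z].
Proof. by have := inner_linear z 1 x y; rewrite scale1r mul1r. Qed.

Lemma inner0l z : '[0, z] = 0.
Proof. by apply: (addIr '[0, z]); rewrite -innerDl !add0r. Qed.

Lemma innerZl (a : R[i]) x z : '[a *: x, z] = a * '[x, z].
Proof. by have := inner_linear z a x 0; rewrite !addr0 inner0l addr0. Qed.

Lemma innerBl x y z : '[x - y, z] = '[x, z] - '[y, z].
Proof. by rewrite innerDl -scaleN1r innerZl mulN1r. Qed.

Lemma innerDr x y z : '[x, y + z] = '[x, y] + '[x, z].
Proof. by rewrite inner_conj innerDl rmorphD /= -!inner_conj. Qed.

Lemma innerZr (a : R[i]) x z : '[x, a *: z] = a^*%R * '[x, z].
Proof. by rewrite inner_conj innerZl rmorphM /= -!inner_conj. Qed.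

Lemma innerBr x y z : '[x, y - z] = '[x, y] - '[x, z].
Proof. by rewrite inner_conj innerBl rmorphB /= -!inner_conj. Qed.

Lemma inner0r z : '[z, 0] = 0.
Proof. by rewrite inner_conj inner0l rmorph0. Qed.

Lemma inner_ge0 x : 0 <= '[x, x].
Proof. by rewrite inner_normE exprn_ge0. Qed.

Lemma inner_eq0 x : ('[x, x] == 0) = (x == 0).
Proof. by rewrite inner_normE expf_eq0 normr_eq0. Qed.

Lemma inner_gt0 x : (0 < '[x, x]) = (x != 0).
Proof. by rewrite lt_def inner_eq0 inner_ge0 andbT. Qed.

Lemma inner_projE u v : v != 0 ->
  '[u - ('[u, v] / '[v, v]) *: v, u - ('[u, v] / '[v, v]) *: v]
  = '[u, u] - `|'[u, v]| ^+ 2 / '[v, v].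
Proof.
move=> v0; have vv0 : '[v, v] != 0 by rewrite inner_eq0.
rewrite !(innerBl, innerBr, innerZl, innerZr) (inner_conj u v).
rewrite rmorphM fmorphV /= -(inner_conj v v) normCK.
move: vv0; set a := '[u, u]; set b := '[v, v]; set c := '[u, v]; set d := _^*%R.
by move=> vv0; field.
Qed.

Lemma inner_CS u v : `|'[u, v]| <= `|u| * `|v|.
Proof.
have [->|v0] := eqVneq v 0; first by rewrite inner0r !normr0 mulr0.
rewrite -(@ler_pXn2r _ 2)// ?nnegrE ?mulr_ge0// exprMn -!inner_normE.
rewrite -ler_pdivrMr ?inner_gt0// -subr_ge0 -inner_projE//.
exact: inner_ge0.
Qed.

Lemma inner_parallelogram u v :
  '[u - v, u - v] = '[u, u] *+ 2 + '[v, v] *+ 2 - '[u + v, u + v].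
Proof. by rewrite !(innerBl, innerBr, innerDl, innerDr) !mulr2n; ring. Qed.

Lemma eq_inner u v : (forall x, '[x, u] = '[x, v]) -> u = v.
Proof.
move=> uv; apply/eqP; rewrite -subr_eq0 -inner_eq0.
by rewrite innerBr uv subrr.
Qed.

Lemma riesz (f : {scalar H}) (M : R) : 0 <= M ->
  (forall x, `|f x| <= M%:C * `|x|) -> exists z, forall x, f x = '[x, z].
Proof.
move=> M0 fM.
have [f0|/existsNP[x0 /eqP fx0]] := pselect (forall x, f x = 0).
  by exists 0 => x; rewrite f0 inner0r.
pose n2 x : R := complex.Re '[x, x].
have n2E x : '[x, x] = (n2 x)%:C by apply/esym/RRe_real/ger0_real/inner_ge0.
have n2_ge0 x : 0 <= n2 x by rewrite -lecR -n2E inner_ge0.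
pose S := [set n2 x | x in [set x | f x = 1]].
have infS : has_inf S.
  split; last by exists 0 => _ [x _ <-].
  exists (n2 ((f x0)^-1 *: x0)), ((f x0)^-1 *: x0) => //=.
  by rewrite linearZ /= mulVf.
pose d := inf S.
have dle x : f x = 1 -> d <= n2 x.
  by move=> fx; apply: ge_inf; [exact: infS.2|exists x].
have /choice[u uP] (n : nat) : exists x, f x = 1 /\ n2 x < d + n.+1%:R^-1.
  have [|_ [x fx <-] xd] := @inf_adherent _ S n.+1%:R^-1 _ infS.
    by rewrite invr_gt0.
  by exists x.
have u_cauchy n m : (n <= m)%N -> n2 (u n - u m) <= 4 * n.+1%:R^-1.
  move=> nm; have [fn un] := uP n; have [fm um] := uP m.
  have mn : m.+1%:R^-1 <= n.+1%:R^-1 :> R by rewrite lef_pV2 ?posrE// ler_nat.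
  have : d <= n2 (2^-1 *: (u n + u m)).
    apply: dle; rewrite linearZ linearD /= fn fm.
    by rewrite -[1 + 1]/(2%:R) mulVf// pnatr_eq0.
  have -> : n2 (2^-1 *: (u n + u m)) = 4^-1 * n2 (u n + u m).
    apply: complexI; rewrite -n2E innerZl innerZr n2E rmorphM /=.
    rewrite !fmorphV !rmorph_nat mulrA -invfM -natrM //.
  have : n2 (u n - u m) = n2 (u n) *+ 2 + n2 (u m) *+ 2 - n2 (u n + u m).
    apply: complexI; rewrite -n2E inner_parallelogram !n2E.
    by rewrite rmorphB rmorphD !rmorphMn.
  move=> ->; rewrite !mulr2n; move: un um mn.
  set a := n2 _; set b := n2 _; set c := n2 _; set e := _^-1; set g := _^-1.
  lra.
have small (e : R) : 0 < e -> exists n : nat, n.+1%:R^-1 < e.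
  move=> e0; exists (Num.truncn e^-1).
  by rewrite invf_plt ?posrE// truncnS_gt.
have small2 (e : R[i]) : 0 < e -> exists2 r : R, 0 < r & r%:C = e.
  move=> e0; exists (complex.Re e); last exact/RRe_real/gtr0_real.
  by rewrite -ltcR RRe_real// gtr0_real.
have norm_lt x (r : R) : 0 < r -> n2 x < r ^+ 2 -> `|x| < r%:C.
  move=> r0 xr; rewrite -(@ltr_pXn2r _ 2)// ?nnegrE// ?lecR ?ltW//.
  by rewrite -inner_normE n2E -rmorphXn ltcR.
have /cauchy_cvgP/cvg_ex[/= z uz] : cauchy (u @ \oo).
  apply: cauchy_exP => e /small2[r r0 <-].
  have [n nr] := small (r ^+ 2 / 4) (divr_gt0 (exprn_gt0 _ r0) (ltr0n _ 4)).
  exists (u n); exists n => // m /= nm.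
  rewrite -ball_normE /=; apply: norm_lt => //.
  apply: le_lt_trans (u_cauchy _ _ nm) _.
  by move: nr; set k := _^-1; lra.
have uzP (e : R) : 0 < e -> forall N, exists2 n, (N <= n)%N & `|z - u n| < e%:C.
  move=> e0 N; have /cvgrPdist_lt/(_ e%:C) : u @ \oo --> z by [].
  rewrite ltcR => /(_ e0) [K _ KP].
  by exists (maxn N K); [exact: leq_maxl|apply: KP; exact: leq_maxr].
have eq0 (a : R[i]) (B : R) :
    (forall e : R, 0 < e -> `|a| <= B%:C * e%:C) -> a = 0.
  move=> aB; apply/eqP; rewrite -normr_eq0; apply: contraT => a0.
  have /small2[r r0 ra] : 0 < `|a| by rewrite lt_def a0 normr_ge0.
  have B1 : 0 < 2 * (`|B| + 1) by rewrite mulr_gt0// ltr_wpDl.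
  have := aB (r / (2 * (`|B| + 1))) (divr_gt0 r0 B1).
  rewrite -ra -rmorphM lecR mulrA ler_pdivlMr// mulrC ler_pM2r//.
  by have := ler_norm B; have := normr_ge0 B; set b := `|B|; lra.
have fz : f z = 1.
  apply/eqP; rewrite -subr_eq0; apply/eqP; apply: (eq0 _ M) => e e0.
  have [n _ zn] := uzP e e0 0%N.
  rewrite -(uP n).1 -linearB; apply: le_trans (fM _) _.
  by apply: ler_wpM2l; [rewrite ler0c|exact: ltW].
have z0 : z != 0.
  by apply/eqP => z0; move: fz; rewrite z0 linear0 => /eqP; rewrite eq_sym oner_eq0.
have zz0 : '[z, z] != 0 by rewrite inner_eq0.
have orth y : f y = 0 -> '[y, z] = 0.
  move=> fy; have [->|y0] := eqVneq y 0; first by rewrite inner0l.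
  pose B := 2 * complex.Re `|y|.
  have yE : `|y| = (complex.Re `|y|)%:C by rewrite RRe_real// ger0_real.
  apply: (eq0 _ B) => e e0.
  have [N Ne] := small (e ^+ 2) (exprn_gt0 _ e0).
  have [n Nn zn] := uzP e e0 N.
  have -> : '[y, z] = '[y, z - u n] + '[y, u n] by rewrite innerBr subrK.
  apply: le_trans (ler_normD _ _) _.
  rewrite /B rmorphM /= -yE -mulrA [2%:C]rmorph_nat mulr_natl mulr2n lerD//.
    by apply: le_trans (inner_CS _ _) _; rewrite ler_wpM2l// ltW.
  rewrite -(@ler_pXn2r _ 2)// ?nnegrE ?mulr_ge0 ?lecR ?(ltW e0)//.
  rewrite exprMn -inner_normE inner_conj norm_conjC mulrC -ler_pdivrMr ?inner_gt0//.
  have : d <= n2 (u n - ('[u n, y] / '[y, y]) *: y).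
    by apply: dle; rewrite linearB linearZ /= fy mulr0 subr0 (uP n).1.
  rewrite -lecR -n2E inner_projE// n2E lerBrDl -lerBrDr => /le_trans; apply.
  rewrite -rmorphB -rmorphXn lecR.
  have := (uP n).2.
  have : n.+1%:R^-1 <= N.+1%:R^-1 :> R by rewrite lef_pV2 ?posrE// ler_nat.
  by move: Ne; set a := N.+1%:R^-1; set b := n.+1%:R^-1; lra.
have fE x : '[x, z] = f x * '[z, z].
  apply/eqP; rewrite -subr_eq0 -innerZl -innerBl orth//.
  by rewrite linearB linearZ /= fz mulr1 subrr.
exists ('[z, z]^-1 *: z) => x.
by rewrite innerZr fmorphV /= -inner_conj (fE x) mulrCA mulVf ?mulr1.
Qed.

Lemma bounded_operatorP (T : bounded_operator H) :
  exists2 M : R, 0 <= M & forall x, `|T x| <= M%:C * `|x|.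
Proof.
have /linear_boundedP/pinfty_ex_gt0[M M0 TM] := @bop_bounded _ _ T.
exists (complex.Re M); first by rewrite -lecR RRe_real ?ltW// gtr0_real.
by move=> x; rewrite RRe_real ?gtr0_real.
Qed.

Lemma adjoint_exists (T : bounded_operator H) :
  exists S : bounded_operator H, forall x y, '[T x, y] = '[x, S y].
Proof.
have [M M0 TM] := bounded_operatorP T.
have /choice[S ST] y : exists z, forall x, '[T x, y] = '[x, z].
  have lf : scalar (fun x => '[T x, y]).
    by move=> a u v; rewrite linearP /= innerDl innerZl.
  pose f : {scalar H} := HB.pack (fun x => '[T x, y])
    (GRing.isLinear.Build _ _ _ _ _ lf).
  apply: (@riesz f (M * complex.Re `|y|)).
    by rewrite mulr_ge0// -lecR RRe_real ?normr_real//; exact: normr_ge0.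
  move=> x; rewrite rmorphM /= RRe_real ?ger0_real// mulrAC.
  by apply: le_trans (inner_CS _ _) _; apply: ler_wpM2r.
have lS : linear S.
  by move=> a u v; apply: eq_inner => x;
    rewrite -ST !(innerDr, innerZr) !ST.
pose S' : {linear H -> H} := HB.pack S (GRing.isLinear.Build _ _ _ _ _ lS).
suff bS : bounded_near S' (nbhs (0 : H)) by exists (BoundedOperator bS).
apply/bounded_funP => r; exists (M%:C * r) => x xr.
apply: (@le_trans _ _ (M%:C * `|x|)); last by apply: ler_wpM2l; rewrite ?ler0c.
rewrite -[S' x]/(S x).
have [->|Sx0] := eqVneq (S x) 0; first by rewrite normr0 mulr_ge0// ler0c.
rewrite -(@ler_pM2r _ `|S x|) ?normr_gt0// -expr2 -inner_normE -ST.
rewrite -(ger0_norm (_ : 0 <= '[T (S x), x])); last by rewrite ST inner_ge0.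
apply: le_trans (inner_CS _ _) _.
by rewrite mulrAC; apply: ler_wpM2r.
Qed.

End RieszAdjoint.

Section Operators.
Variables (R : realType) (H : hilbertType R).
Implicit Types T S : bounded_operator H.

Definition adjoint T : bounded_operator H := projT1 (cid (adjoint_exists T)).

Lemma adjointP T (x y : H) : inner (T x) y = inner x (adjoint T y).
Proof. exact: (projT2 (cid (adjoint_exists T))). Qed.

Definition normal_operator T := T \o adjoint T = adjoint T \o T :> (H -> H).

(* The supremum is finite only for bounded linear maps; [sup] is 0 otherwise. *)
Definition opnorm (f : H -> H) : R :=
  sup [set complex.Re `|f x| | x in [set x | `|x| <= 1]].

Definition spectrum T : set R[i] :=
  [set lambda | ~ exists S : bounded_operator H,
     (forall x, S (T x - lambda *: x) = x) /\
     (forall x, T (S x) - lambda *: S x = x)].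

Definition A_class (alpha : R[i]) : set (bounded_operator H) :=
  [set T | opnorm (fun x => alpha *: T x - x) <= 1].

End Operators.

Definition separable_space (X : topologicalType) :=
  exists D : set X, countable D /\ dense D.

Definition cis (R : realType) (t : R) : R[i] := cos t +i* sin t.

(* The principal argument, in ]-pi, pi]; its value at 0 is irrelevant. *)
Definition Carg (R : realType) (z : R[i]) : R :=
  let t := acos (complex.Re z / complex.Re `|z|) in
  if 0 <= complex.Im z then t else - t.

Lemma CargP (R : realType) (z : R[i]) : z != 0 -> z = `|z| * cis (Carg z).
Proof.
case: z => a b z0; rewrite /Carg /cis normc_def /=.
have ab0 : 0 < a ^+ 2 + b ^+ 2.
  rewrite lt_def addr_ge0 ?sqr_ge0// andbT paddr_eq0 ?sqr_ge0// !sqrf_eq0.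
  by apply: contra z0 => /andP[/eqP -> /eqP ->].
set r := Num.sqrt _; have r0 : 0 < r by rewrite sqrtr_gt0.
have r2 : r ^+ 2 = a ^+ 2 + b ^+ 2 by rewrite sqr_sqrtr// ltW.
have ar : -1 <= a / r <= 1.
  rewrite -ler_norml normrM normfV (gtr0_norm r0) ler_pdivrMr// mul1r.
  by rewrite -sqrtr_sqr ler_sqrt ?(ltW ab0)// lerDl sqr_ge0.
have ss : Num.sqrt (1 - (a / r) ^+ 2) = `|b| / r.
  have -> : 1 - (a / r) ^+ 2 = (`|b| / r) ^+ 2.
    rewrite !expr_div_n real_normK ?num_real// r2 -[1](@divff _ (a ^+ 2 + b ^+ 2)) ?gt_eqF//.
    by rewrite -mulrBl addrC addKr.
  by rewrite sqrtr_sqr ger0_norm// divr_ge0// ltW.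
apply/eqP; rewrite eq_complex /= !mul0r subr0 addr0.
have rne : r != 0 by rewrite gt_eqF.
case: ifP => b0; rewrite ?cosN ?sinN acosK// sin_acos// ss.
  by rewrite ger0_norm// ![r * _]mulrC !divfK// !eqxx.
rewrite ltr0_norm ?ltNge ?b0// mulrN ![r * _]mulrC !divfK// opprK.
by rewrite !eqxx.
Qed.

(* The class of t modulo 2 pi meets the open interval ]a, b[. *)
Definition in_mod2pi (R : realType) (t a b : R) :=
  exists k : int, a < t + k%:~R * (2 * pi) < b.

(* Main.v *)
Require Import Defs.
From HB Require Import structures.
From mathcomp Require Import all_boot all_order all_algebra.
From mathcomp Require Import complex.
From mathcomp Require Import all_classical all_reals all_analysis.
From mathcomp Require Import ring lra.

Import Order.TTheory GRing.Theory Num.Theory.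
Import numFieldNormedType.Exports.

Local Open Scope classical_set_scope.
Local Open Scope complex_scope.
Local Open Scope ring_scope.

(** The operator [N = alpha T - I] is normal, and the norm of a normal operator
is attained on its spectrum: some [lambda] in the spectrum of [T] satisfies
[|alpha lambda - 1| = ||N||] as soon as [N] is nonzero. So it suffices to bound
[|alpha lambda - 1|] by 1 on the spectrum of [T]. Write
[alpha lambda = t e^(i a)] with [t = |alpha| |lambda|] and
[a = arg alpha + arg lambda]; then [|t e^(i a) - 1|^2 = 1 - t (2 cos a - t)],
and the hypothesis on [|alpha|], together with [|lambda| <= ||T||], says that
[t <= 2 cos a].

That the norm is attained on the spectrum is proved without the spectral
theorem or the spectral radius formula. Let [nu = ||N||]. Normality makes [N]
paranormal, [||N x||^2 <= ||x|| ||N^2 x||], so the ratios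
[||N^(k+1) x|| / ||N^k x||] do not decrease with [k] ([rnorm_iter_ge]): if
[||N x||] is nearly [nu ||x||], then [||N^k x||] stays comparable to
[nu^k ||x||] for all [k < n]. For [z] on the circle of radius [nu], put
[u = \sum_(k < n) z^(-k) N^k x]. The sum [(N - z) u] telescopes, hence has norm
at most [2 nu ||x||], whereas by Parseval's identity over the [n]-th roots of
unity ([parseval]) the mean of [||u||^2] over [n] equidistributed values of [z]
is of order [n ||x||^2]. So for some [z] the ratio [||(N - z) u|| / ||u||] is of
order [nu / sqrt n] ([approx_eigenvector]). By compactness of the circle, these
[z] accumulate at an approximate eigenvalue of modulus [nu]
([approx_eigenvalue]), which has to belong to the spectrum. *)

(** * Real-valued norms *)

Section RealNorm.
Context {R : realType}.

(** The norm of a complex normed space takes its values in the complex numbers;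
its real part is used instead, so that norms can be compared in a totally
ordered field. *)
Definition rnorm {V : normedZmodType R[i]} (x : V) : R := complex.Re `|x|.

Section NormedZmod.
Context {V : normedZmodType R[i]}.
Implicit Types x y : V.

Lemma rnormE x : `|x| = (rnorm x)%:C.
Proof. by rewrite RRe_real// normr_real. Qed.

Lemma rnorm_ge0 x : 0 <= rnorm x.
Proof. by rewrite -lecR -rnormE normr_ge0. Qed.

Lemma rnorm0 : rnorm (0 : V) = 0.
Proof. by apply: complexI; rewrite -rnormE normr0. Qed.

Lemma rnorm_gt0 x : (0 < rnorm x) = (x != 0).
Proof. by rewrite -ltcR -rnormE normr_gt0. Qed.

Lemma ler_rnormD x y : rnorm (x + y) <= rnorm x + rnorm y.
Proof. by rewrite -lecR rmorphD /= -!rnormE ler_normD. Qed.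

Lemma ler_rnormB x y : rnorm (x - y) <= rnorm x + rnorm y.
Proof. by rewrite -lecR rmorphD /= -!rnormE ler_normB. Qed.

End NormedZmod.

Lemma rnormZ {V : normedModType R[i]} (a : R[i]) (x : V) :
  rnorm (a *: x) = rnorm a * rnorm x.
Proof. by apply: complexI; rewrite rmorphM /= -!rnormE normrZ. Qed.

Lemma rnormM (a b : R[i]) : rnorm (a * b) = rnorm a * rnorm b.
Proof. by apply: complexI; rewrite rmorphM /= -!rnormE normrM. Qed.

Lemma rnorm_real (r : R) : 0 <= r -> rnorm r%:C = r.
Proof. by move=> r0; apply: complexI; rewrite -rnormE ger0_norm// ler0c. Qed.

Lemma rnorm_sqr (z : R[i]) :
  rnorm z ^+ 2 = complex.Re z ^+ 2 + complex.Im z ^+ 2.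
Proof. by rewrite /rnorm normc_def /= sqr_sqrtr// addr_ge0 ?sqr_ge0. Qed.

Lemma rnorm_le_ReIm (z : R[i]) :
  rnorm z <= `|complex.Re z| + `|complex.Im z|.
Proof.
rewrite -(@ler_pXn2r _ 2)// ?nnegrE ?rnorm_ge0 ?addr_ge0//.
rewrite rnorm_sqr sqrrD !real_normK ?num_real// lerD2r lerDl.
by rewrite mulrn_wge0 ?mulr_ge0.
Qed.

End RealNorm.

(** * Roots of unity on the unit circle *)

Section UnitCircle.
Context {R : realType}.
Implicit Types s t : R.

Lemma cisD s t : cis (s + t) = cis s * cis t.
Proof.
rewrite /cis cosD sinD; apply/eqP; rewrite eq_complex /= eqxx /=.
by apply/eqP; ring.
Qed.

Lemma cisX t n : cis t ^+ n = cis (t *+ n).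
Proof.
elim: n => [|n IH]; last by rewrite exprS IH mulrS cisD.
by rewrite mulr0n /cis cos0 sin0 expr0.
Qed.

Lemma rnorm_cis t : rnorm (cis t) = 1.
Proof.
apply/eqP; rewrite -(@pexpr_eq1 _ _ 2) ?rnorm_ge0//.
by rewrite rnorm_sqr /= cos2Dsin2.
Qed.

Lemma cisN t : cis (- t) = (cis t)^-1.
Proof.
have := cisD t (- t).
rewrite subrr [cis 0]/cis cos0 sin0 => ct1.
have c0 : cis t != 0 by rewrite -rnorm_gt0 rnorm_cis.
by apply: (mulfI c0); rewrite -ct1 mulfV.
Qed.

Lemma cis_neq1 t : 0 < t < 2 * pi -> cis t != 1.
Proof.
move=> /andP[t0 t2pi]; apply/eqP => -[].
have -> : t = (t / 2) *+ 2 by rewrite -(mulr_natr (t / 2)) divfK.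
rewrite cos_mulr2n cos2sin2 => ct _.
have : 0 < sin (t / 2) by apply: sin_gt0_pi; lra.
move=> /(exprn_gt0 2); move: ct; rewrite mulr2n; lra.
Qed.

Lemma cis_prim_root n : (0 < n)%N ->
  n.-primitive_root (cis (2 * pi / n%:R : R)).
Proof.
move=> n0; have nR : 0 < n%:R :> R by rewrite ltr0n.
apply/andP; split => //; apply/forallP => i; rewrite unity_rootE cisX.
have [->|ni] := eqVneq i.+1 n.
  rewrite -(mulr_natr (_ / _)) divfK ?lt0r_neq0// mulr_natl /cis cos2pi sin2pi.
  by rewrite eqxx.
rewrite (negPf (cis_neq1 _ _))//.
have in1 : (i.+1 < n)%N by rewrite ltn_neqAle ni ltn_ord.
rewrite -(mulr_natr (_ / _)) -mulrA.
rewrite !mulr_gt0 ?invr_gt0 ?pi_gt0 ?ltr0n//=.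
rewrite gtr_pMr ?mulr_gt0 ?pi_gt0//.
by rewrite mulrC ltr_pdivrMr// mul1r ltr_nat.
Qed.

End UnitCircle.

(** * Parseval's identity over the roots of unity *)

Section HilbertSums.
Context {R : realType} {H : hilbertType R}.

Lemma rnorm_sqrE (x : H) : (rnorm x ^+ 2)%:C = inner x x.
Proof. by rewrite inner_normE rnormE rmorphXn. Qed.

Lemma inner_suml I (r : seq I) (f : I -> H) y :
  inner (\sum_(i <- r) f i) y = \sum_(i <- r) inner (f i) y.
Proof.
elim: r => [|i r IH]; first by rewrite !big_nil inner0l.
by rewrite !big_cons innerDl IH.
Qed.

Lemma inner_sumr I (r : seq I) (f : I -> H) y :
  inner y (\sum_(i <- r) f i) = \sum_(i <- r) inner y (f i).
Proof.
elim: r => [|i r IH]; first by rewrite !big_nil inner0r.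
by rewrite !big_cons innerDr IH.
Qed.

(** Expanding the squares gives [\sum_k \sum_l inner (v k) (v l)] weighted by
sums of powers of [zeta], which vanish unless [k = l]. *)
Lemma parseval (n : nat) (zeta : R[i]) (v : 'I_n -> H) :
  n.-primitive_root zeta -> rnorm zeta = 1 ->
  \sum_(j < n) rnorm (\sum_(k < n) (zeta ^+ j) ^+ k *: v k) ^+ 2 =
  n%:R * \sum_(k < n) rnorm (v k) ^+ 2.
Proof.
move=> pz z1; have z0 : zeta != 0 by rewrite -rnorm_gt0 z1.
have zJ : zeta^*%R = zeta^-1.
  by apply: (mulfI z0); rewrite -normCK rnormE z1 expr1n mulfV.
(* Orthogonality of the characters of the cyclic group of order n; off the
   diagonal this is a geometric sum of ratio w <> 1 with w ^+ n = 1. *)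
have orth (k l : 'I_n) :
    \sum_(j < n) (zeta ^+ j) ^+ k * ((zeta ^+ j) ^+ l)^*%R =
    if k == l then n%:R else 0.
  pose w := zeta ^+ k / zeta ^+ l.
  have -> : \sum_(j < n) (zeta ^+ j) ^+ k * ((zeta ^+ j) ^+ l)^*%R =
      \sum_(j < n) w ^+ j.
    apply: eq_bigr => j _; rewrite !rmorphXn /= zJ !exprVn /w expr_div_n.
    by rewrite -!exprM ![(j * _)%N]mulnC.
  case: eqVneq => kl.
    rewrite /w kl divff ?expf_neq0//.
    by under eq_bigr do rewrite expr1n; rewrite sumr_const card_ord.
  have w1 : w - 1 != 0.
    rewrite subr_eq0; apply: contra kl => /eqP wE.
    have : zeta ^+ k == zeta ^+ l.
      by rewrite -[X in _ == X]mul1r -wE /w divfK ?expf_neq0.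
    by rewrite (eq_prim_root_expr pz) !modn_small.
  apply: (mulfI w1); rewrite -subrX1 mulr0 /w expr_div_n -!exprM.
  rewrite ![(_ * n)%N]mulnC !exprM (prim_expr_order pz) !expr1n divr1.
  by rewrite subrr.
apply: complexI; rewrite rmorphM !rmorph_sum /= rmorph_nat.
transitivity (\sum_(j < n) \sum_(k < n) \sum_(l < n)
    ((zeta ^+ j) ^+ k * ((zeta ^+ j) ^+ l)^*%R) * inner (v k) (v l)).
  apply: eq_bigr => j _; rewrite rnorm_sqrE inner_suml.
  apply: eq_bigr => k _; rewrite inner_sumr; apply: eq_bigr => l _.
  by rewrite innerZl innerZr mulrA.
rewrite exchange_big mulr_sumr /=; apply: eq_bigr => k _.
rewrite exchange_big /=.
under eq_bigr do rewrite -mulr_suml orth.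
rewrite (bigD1 k)//= eqxx big1 ?addr0 => [|l lk]; first by rewrite rnorm_sqrE.
by rewrite eq_sym (negPf lk) mul0r.
Qed.

(** If all terms of the sum over [j] in [parseval] were smaller than
[\sum_k ||v k||^2], so would be their mean. *)
Lemma parseval_exists (n : nat) (zeta : R[i]) (v : 'I_n -> H) :
  n.-primitive_root zeta -> rnorm zeta = 1 ->
  exists j : 'I_n, \sum_(k < n) rnorm (v k) ^+ 2 <=
    rnorm (\sum_(k < n) (zeta ^+ j) ^+ k *: v k) ^+ 2.
Proof.
move=> pz z1; apply: contrapT => /forallNP small.
have n0 := prim_order_gt0 pz.
suff : \sum_(j < n) rnorm (\sum_(k < n) (zeta ^+ j) ^+ k *: v k) ^+ 2 <
    \sum_(j < n) \sum_(k < n) rnorm (v k) ^+ 2.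
  by rewrite parseval// sumr_const card_ord mulr_natl ltxx.
apply: ltr_sum => [|j _]; last by rewrite ltNge; apply/negP/small.
by apply/hasP; exists (Ordinal n0) => //; rewrite mem_index_enum.
Qed.

End HilbertSums.

(** * Approximate eigenvalues of paranormal operators *)

Lemma bernoulli_sub (R : realType) (d : R) (k : nat) : 0 <= d <= 1 ->
  1 - k%:R * d <= (1 - d) ^+ k.
Proof.
move=> /andP[d0 d1]; elim: k => [|k IH]; first by rewrite expr0; lra.
rewrite exprS; apply: le_trans (ler_wpM2l _ IH); last lra.
by rewrite -natr1; have : 0 <= k%:R :> R by []; nra.
Qed.

Section Paranormal.
Context {R : realType} {H : hilbertType R}.
Variables (N : {linear H -> H}) (nu : R).
Hypothesis nu_gt0 : 0 < nu.
Hypothesis N_le : forall x, rnorm (N x) <= nu * rnorm x.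
Hypothesis N_sharp : forall q, q < nu ->
  exists2 x : H, x != 0 & q * rnorm x <= rnorm (N x).
Hypothesis N_paranormal : forall x, rnorm (N x) ^+ 2 <= rnorm x * rnorm (N (N x)).

(** Paranormality propagates a lower bound [q] on the ratio [||N y|| / ||y||]
from [y] to [N y]. *)
Lemma rnorm_iter_ge (q : R) (x : H) : 0 <= q ->
  q * rnorm x <= rnorm (N x) ->
  forall k, q ^+ k * rnorm x <= rnorm (iter k N x).
Proof.
move=> q0 qx k.
have step j : q * rnorm (iter j N x) <= rnorm (iter j.+1 N x).
  elim: j => [//|j]; rewrite !iterS; set y := iter j N x => IH.
  have [y0|y0] := eqVneq y 0; first by rewrite y0 !linear0 rnorm0 mulr0.
  rewrite -rnorm_gt0 in y0.
  rewrite -(ler_pM2l y0); apply: le_trans (N_paranormal y).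
  by rewrite mulrA [_ * q]mulrC expr2 ler_wpM2r ?rnorm_ge0.
elim: k => [|k IH]; first by rewrite expr0 mul1r.
apply: le_trans (step k).
by rewrite exprS -mulrA ler_wpM2l.
Qed.

Lemma rnorm_iter_le (x : H) k : rnorm (iter k N x) <= nu ^+ k * rnorm x.
Proof.
elim: k => [|k IH]; first by rewrite expr0 mul1r.
apply: le_trans (N_le _) _.
by rewrite exprS -mulrA ler_wpM2l// ltW.
Qed.

(** The vector [u] is a geometric sum [\sum_(k < n) z^(-k) N^k x], where [x]
almost attains the norm of [N]: [(N - z) u] has only two terms left, while
Parseval's identity makes [u] large for one of the [n] candidates for [z]. The
angle is confined to a segment for the sake of the compactness argument in
[approx_eigenvalue]. *)
Lemma approx_eigenvector (n : nat) : (0 < n)%N ->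
  exists t : R, 0 <= t <= 2 * pi /\ exists2 u : H, u != 0 &
    n%:R * rnorm (N u - (nu%:C * cis (- t)) *: u) ^+ 2 <=
    (4 * nu) ^+ 2 * rnorm u ^+ 2.
Proof.
move=> n0; have n1 : 1 <= n%:R :> R by rewrite ler1n.
have n2 : 0 < 2 * n%:R :> R by lra.
(* With this q, Bernoulli's inequality gives (q / nu) ^+ k >= 1 / 2 for k < n. *)
pose q := nu * (1 - (2 * n%:R)^-1).
have d0 : 0 < (2 * n%:R)^-1 :> R by rewrite invr_gt0.
have d1 : (2 * n%:R)^-1 <= 1 :> R by rewrite invf_le1; lra.
have q0 : 0 <= q by rewrite mulr_ge0 ?(ltW nu_gt0)//; lra.
have [|x x0 qx] := N_sharp q.
  by rewrite /q gtr_pMr//; lra.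
have xp : 0 < rnorm x by rewrite rnorm_gt0.
have nuC : nu%:C != 0 :> R[i] by rewrite -rnorm_gt0 rnorm_real ?ltW.
have nuVn k : rnorm ((nu%:C ^-1) ^+ k) = (nu ^-1) ^+ k.
  by rewrite -fmorphV -rmorphXn /= rnorm_real// exprn_ge0// invr_ge0 ltW.
pose v k := (nu%:C ^-1) ^+ k *: iter k N x.
have vge k : (k < n)%N -> rnorm x / 2 <= rnorm (v k).
  move=> kn; rewrite rnormZ nuVn.
  have := rnorm_iter_ge q x q0 qx k; rewrite /q exprMn => le1.
  apply: le_trans (ler_wpM2l _ le1); last by rewrite exprn_ge0// invr_ge0 ltW.
  rewrite !mulrA -exprMn mulVf ?gt_eqF// expr1n mul1r mulrC.
  rewrite ler_wpM2r ?rnorm_ge0//.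
  apply: le_trans (bernoulli_sub _ _ k _); last by rewrite ltW.
  have : k%:R / (2 * n%:R) <= 2^-1 :> R; last lra.
  rewrite ler_pdivrMr// mulrA mulVf// mul1r ler_nat; exact: ltnW.
set zeta := cis (2 * pi / n%:R : R).
have [j] := parseval_exists n zeta (fun k => v k) (cis_prim_root n n0) (rnorm_cis _).
set u : H := \sum_(k < n) _ *: _ => u_big.
have {u_big} u_big : n%:R * (rnorm x / 2) ^+ 2 <= rnorm u ^+ 2.
  apply: le_trans u_big.
  rewrite -[n in n%:R]card_ord mulr_natl -sumr_const ler_sum// => k _.
  by rewrite ler_pXn2r ?vge// nnegrE ?rnorm_ge0// divr_ge0// rnorm_ge0.
pose t := 2 * pi / n%:R *+ j : R.
have zj : zeta ^+ j = cis t by rewrite cisX.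
exists t; split.
  have pi0 := pi_gt0 R.
  rewrite mulrn_wge0 ?divr_ge0 ?mulr_ge0 ?(ltW pi0)//=.
  rewrite /t -(mulr_natr (_ / _)) -mulrA ger_pMr ?mulr_gt0// mulrC ler_pdivrMr ?mul1r ?ltr0n//.
  by rewrite ler_nat ltnW.
exists u.
  rewrite -rnorm_gt0 lt_neqAle rnorm_ge0 andbT eq_sym -(sqrf_eq0 (rnorm u)).
  by rewrite gt_eqF// (lt_le_trans _ u_big)// mulr_gt0 ?exprn_gt0 ?divr_gt0 ?ltr0n.
(* As N (b k) = z b_(k+1), the sum N u - z u telescopes. *)
pose z := nu%:C * cis (- t).
pose b k := z^-1 ^+ k *: iter k N x.
have c0 : cis t != 0 by rewrite -rnorm_gt0 rnorm_cis.
have z0 : z != 0 by rewrite /z cisN mulf_neq0 ?invr_neq0.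
have uE : u = \sum_(k < n) b k.
  apply: eq_bigr => k _; rewrite scalerA zj -exprMn /b /z invfM cisN invrK.
  by rewrite mulrC.
have NuE : N u - z *: u = z *: (b n - b 0).
  rewrite uE linear_sum scaler_sumr -sumrB -(telescope_sumr b (leq0n n)).
  rewrite big_mkord scaler_sumr; apply: eq_bigr => k _.
  by rewrite scalerBr; congr (_ - _); rewrite linearZ /= scalerA exprS mulrA mulfV// mul1r.
have rz : rnorm z = nu by rewrite rnormM rnorm_cis mulr1 rnorm_real ?ltW.
have bn : rnorm (b n) <= rnorm x.
  rewrite rnormZ; have -> : rnorm (z^-1 ^+ n) = nu^-1 ^+ n.
    by rewrite /z invfM cisN invrK exprMn cisX rnormM nuVn rnorm_cis mulr1.
  apply: le_trans (ler_wpM2l _ (rnorm_iter_le x n)) _.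
    by rewrite exprn_ge0// invr_ge0 ltW.
  by rewrite mulrA -exprMn mulVf ?gt_eqF// expr1n mul1r.
rewrite -/z NuE rnormZ rz.
have b_le : rnorm (b n - b 0) <= 2 * rnorm x.
  apply: le_trans (ler_rnormB _ _) _.
  by rewrite mulr_natl mulr2n lerD// /b expr0 scale1r.
have : rnorm (b n - b 0) ^+ 2 <= (2 * rnorm x) ^+ 2.
  by rewrite ler_pXn2r// nnegrE ?rnorm_ge0// mulr_ge0// ltW.
move=> b2.
apply: (@le_trans _ _ (n%:R * (nu ^+ 2 * (2 * rnorm x) ^+ 2))).
  by rewrite exprMn ler_wpM2l// ler_wpM2l ?sqr_ge0.
have -> : n%:R * (nu ^+ 2 * (2 * rnorm x) ^+ 2) =
   (4 * nu) ^+ 2 * (n%:R * (rnorm x / 2) ^+ 2) by field.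
by rewrite ler_wpM2l// sqr_ge0.
Qed.

(** The value [z] is a cluster point of the ones that [approx_eigenvector]
provides for [n = 1, 2, ...]. *)
Lemma approx_eigenvalue : exists z : R[i], rnorm z = nu /\
  forall e : R, 0 < e -> exists2 u : H, u != 0 &
    rnorm (N u - z *: u) <= e * rnorm u.
Proof.
have /choice[t tP] n : exists t : R, 0 <= t <= 2 * pi /\ exists2 u : H, u != 0 &
    n.+1%:R * rnorm (N u - (nu%:C * cis (- t)) *: u) ^+ 2 <=
    (4 * nu) ^+ 2 * rnorm u ^+ 2 by exact: approx_eigenvector.
have [] := @segment_compact R 0 (2 * pi) (t @ \oo) _.
  by exists 0%N => // n _ /=; rewrite in_itv /=; have [] := tP n.
move=> s [_ s_cluster]; exists (nu%:C * cis (- s)); split.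
  by rewrite rnormM rnorm_cis mulr1 rnorm_real ?ltW.
move=> e e0.
pose d := e / (4 * nu).
have d0 : 0 < d by rewrite divr_gt0// mulr_gt0.
have near_s : nbhs s [set r : R | `|cos (- s) - cos (- r)| < d /\
                                  `|sin (- s) - sin (- r)| < d].
  have cN : {for s, continuous (fun r : R => - r)} by exact: opp_continuous.
  have cc : (fun r : R => cos (- r)) @ s --> cos (- s).
    exact: (continuous_comp cN (@continuous_cos R (- s))).
  have cs : (fun r : R => sin (- r)) @ s --> sin (- s).
    exact: (continuous_comp cN (@continuous_sin R (- s))).
  by apply: filterI; [move/cvgrPdist_lt: cc|move/cvgrPdist_lt: cs]; apply.
(* For n >= m the approximate eigenvector of index n has error at most e / 2. *)
pose m := Num.truncn ((8 * nu / e) ^+ 2).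
have tail : (t @ \oo) [set t n | n in [set n | (m <= n)%N]].
  by exists m => // n mn; exists n.
have [_ [[n /= mn <-] [/= dcos dsin]]] := s_cluster _ _ tail near_s.
have [_ [u u0 uP]] := tP n; exists u => //.
have up : 0 < rnorm u by rewrite rnorm_gt0.
have -> : N u - (nu%:C * cis (- s)) *: u = (N u - (nu%:C * cis (- t n)) *: u) -
    (nu%:C * (cis (- s) - cis (- t n))) *: u.
  by rewrite mulrBr scalerBl opprB addrA subrK.
apply: le_trans (ler_rnormB _ _) _.
have half1 : rnorm (N u - (nu%:C * cis (- t n)) *: u) <= e / 2 * rnorm u.
  rewrite -(@ler_pXn2r _ 2)// ?nnegrE ?rnorm_ge0 ?mulr_ge0 ?rnorm_ge0 ?divr_ge0 ?(ltW e0)//.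
  rewrite -(@ler_pM2l _ n.+1%:R) ?ltr0n//; apply: le_trans uP _.
  rewrite [X in _ <= _ * X]exprMn [leRHS]mulrA ler_wpM2r ?sqr_ge0//.
  have : (8 * nu / e) ^+ 2 < n.+1%:R.
    by apply: lt_le_trans (truncnS_gt _) _; rewrite ler_nat ltnS.
  move=> /ltW /(ler_wpM2r (sqr_ge0 (e / 2))); apply: le_trans; rewrite -exprMn.
  by have -> // : 8 * nu / e * (e / 2) = 4 * nu by field; rewrite gt_eqF.
have half2 : rnorm ((nu%:C * (cis (- s) - cis (- t n))) *: u) <= e / 2 * rnorm u.
  rewrite rnormZ ler_wpM2r ?rnorm_ge0// rnormM rnorm_real ?(ltW nu_gt0)//.
  have -> : e / 2 = nu * (d + d) by rewrite /d; field; rewrite gt_eqF.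
  rewrite ler_wpM2l ?(ltW nu_gt0)//; apply: le_trans (rnorm_le_ReIm _) _.
  by rewrite lerD// ltW.
lra.
Qed.

End Paranormal.

(** * The norm of [alpha T - I] and the spectrum of [T] *)

Section AffineNormal.
Context {R : realType} {H : hilbertType R}.

(** The adjoint [M] of [N] commutes with [N], so [||M y|| = ||N y||] for every
[y], and [||N x||^2 = inner x (M (N x)) <= ||x|| ||M (N x)||] by
Cauchy-Schwarz. *)
Lemma normal_affine_paranormal (T : bounded_operator H) (alpha : R[i])
    (N : H -> H) (x : H) :
  normal_operator T -> (forall y, N y = alpha *: T y - y) ->
  rnorm (N x) ^+ 2 <= rnorm x * rnorm (N (N x)).
Proof.
move=> nT NE.
pose M y := alpha^*%R *: adjoint T y - y.
have adjN y z : inner (N y) z = inner y (M z).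
  by rewrite NE innerBl innerZl adjointP innerBr innerZr conjCK.
have adjM y z : inner (M y) z = inner y (N z).
  by rewrite inner_conj -adjN -inner_conj.
have MN y : N (M y) = M (N y).
  rewrite /M !NE !linearB !linearZ /= !scalerA.
  have -> : T (adjoint T y) = adjoint T (T y) by have := congr1 (fun f => f y) nT.
  by rewrite [_^*%R * _]mulrC [in RHS]addrACA.
have normM y : rnorm (M y) = rnorm (N y).
  apply/eqP; rewrite -(@eqrXn2 _ 2) ?rnorm_ge0//; apply/eqP/complexI.
  by rewrite !rnorm_sqrE adjM MN -adjN.
rewrite -(normM (N x)) -lecR rnorm_sqrE rmorphM /= -!rnormE adjN.
rewrite -[leLHS]ger0_norm ?inner_CS//.
by rewrite -adjN inner_ge0.
Qed.

(** The bound [c] is the inverse of a bound for the resolvent. *)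
Lemma not_spectrum_lower_bound (T : bounded_operator H) (lambda : R[i]) :
  ~ spectrum T lambda ->
  exists2 c : R, 0 < c & forall u, c * rnorm u <= rnorm (T u - lambda *: u).
Proof.
move=> /contrapT[S [SK _]]; have [M M0 SM] := bounded_operatorP S.
have M1 : 0 < M + 1 by lra.
exists (M + 1)^-1; first by rewrite invr_gt0.
move=> u; rewrite mulrC ler_pdivrMr// mulrC.
apply: (@le_trans _ _ (M * rnorm (T u - lambda *: u))).
  by rewrite -lecR rmorphM /= -!rnormE -{1}(SK u).
by rewrite ler_wpM2r ?rnorm_ge0//; lra.
Qed.

Lemma has_sup_opnorm (f : H -> H) (C : R) :
  (forall x, rnorm (f x) <= C * rnorm x) ->
  has_sup [set complex.Re `|f x| | x in [set x | `|x| <= 1]].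
Proof.
move=> fC; split; first by exists (rnorm (f 0)), 0 => //=; rewrite normr0.
exists `|C| => _ [x /= x1 <-]; apply: le_trans (fC x) _.
rewrite rnormE -[1]/(1%:C) lecR in x1.
apply: le_trans (ler_wpM2r (rnorm_ge0 x) (ler_norm C)) _.
by rewrite -[leRHS]mulr1 ler_wpM2l.
Qed.

(** An approximate eigenvalue [z] of [alpha T - I] of modulus [nu], as given by
[approx_eigenvalue], yields the point [(z + 1) / alpha] of the spectrum of
[T], because [alpha T - I - z = alpha (T - (z + 1) / alpha)] is not bounded
below. *)
Lemma affine_spectrum_attains_norm (T : bounded_operator H) (alpha : R[i]) :
  normal_operator T -> alpha != 0 ->
  0 < opnorm (fun x => alpha *: T x - x) ->
  exists2 lambda, spectrum T lambda &
    rnorm (alpha * lambda - 1) = opnorm (fun x => alpha *: T x - x).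
Proof.
move=> nT a0; set nu := opnorm _ => nu0; pose f x := alpha *: T x - x.
have lf : linear f.
  move=> c x y; rewrite /f linearP /= !scalerDr !scalerN !scalerA mulrC.
  by rewrite opprD !addrA; congr (_ - y); rewrite addrAC.
pose N : {linear H -> H} := HB.pack f (GRing.isLinear.Build _ _ _ _ _ lf).
have [M M0 TM] := bounded_operatorP T.
have NC x : rnorm (N x) <= (rnorm alpha * M + 1) * rnorm x.
  apply: le_trans (ler_rnormB _ _) _; rewrite mulrDl mul1r lerD2r rnormZ -mulrA.
  by rewrite ler_wpM2l ?rnorm_ge0// -lecR rmorphM /= -!rnormE.
have hs := has_sup_opnorm f _ NC.
have N_le x : rnorm (N x) <= nu * rnorm x.
  have [->|x0] := eqVneq x 0; first by rewrite linear0 rnorm0 mulr0.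
  have xp : 0 < rnorm x by rewrite rnorm_gt0.
  rewrite -ler_pdivrMr//.
  have -> : rnorm (N x) / rnorm x = rnorm (N ((rnorm x)^-1%:C *: x)).
    by rewrite linearZ /= rnormZ rnorm_real ?invr_ge0 ?ltW// mulrC.
  apply: (ub_le_sup hs.2); exists ((rnorm x)^-1%:C *: x) => //=.
  by rewrite rnormE -[1]/(1%:C) lecR rnormZ rnorm_real ?invr_ge0 ?rnorm_ge0// mulVf ?gt_eqF.
(* The maximum with 0 excludes x = 0 as a maximizing vector when q < 0. *)
have N_sharp q : q < nu -> exists2 x : H, x != 0 & q * rnorm x <= rnorm (N x).
  move=> qnu; have e0 : 0 < nu - Num.max q 0 by rewrite subr_gt0 gt_max qnu.
  have [_ [x /= x1 <-]] := sup_adherent e0 hs.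
  rewrite -/(opnorm f) -/nu subKr -/(rnorm (f x)) gt_max => /andP[qx fx].
  rewrite rnormE -[1]/(1%:C) lecR in x1.
  exists x.
    by apply/eqP => xE; move: fx; rewrite xE [f 0](linear0 N) rnorm0 ltxx.
  have [q0|q0] := leP 0 q.
    by apply: le_trans (ltW qx); rewrite -[leRHS]mulr1 ler_wpM2l.
  by apply: le_trans (rnorm_ge0 _); rewrite mulr_le0_ge0 ?rnorm_ge0 ?ltW.
have [z [zn zP]] := approx_eigenvalue N nu nu0 N_le N_sharp
  (fun x => normal_affine_paranormal T alpha N x nT (fun=> erefl)).
exists ((z + 1) / alpha); last by rewrite mulrC divfK// addrK.
apply: contrapT => /not_spectrum_lower_bound[c c0 cP].
have ac : 0 < rnorm alpha * c / 2 by rewrite divr_gt0 ?mulr_gt0// rnorm_gt0.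
have [u u0] := zP _ ac.
have -> : N u - z *: u = alpha *: (T u - ((z + 1) / alpha) *: u).
  rewrite scalerBr scalerA [alpha * _]mulrC divfK// scalerDl scale1r.
  by rewrite opprD addrA addrAC.
have up : 0 < rnorm u by rewrite rnorm_gt0.
have ap : 0 < rnorm alpha by rewrite rnorm_gt0.
rewrite rnormZ => le1; have := le_trans (ler_wpM2l (ltW ap) (cP u)) le1.
have : 0 < rnorm alpha * c * rnorm u by rewrite !mulr_gt0.
move: (rnorm alpha) => a; lra.
Qed.

End AffineNormal.

(** * The bound on the spectrum *)

(** The square of the left-hand side is [1 - t (2 cos a - t)]. *)
Lemma rnorm_polar_sub1 (R : realType) (t a : R) :
  0 <= t <= 2 * cos a -> rnorm (t%:C * cis a - 1) <= 1.
Proof.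
move=> /andP[t0 ta]; rewrite -(@ler_pXn2r _ 2)// ?nnegrE ?rnorm_ge0//.
rewrite rnorm_sqr /= !mul0r !subr0 addr0 expr1n.
have := cos2Dsin2 a; move: (cos a) (sin a) ta => c s ta cs.
have -> : (t * c - 1) ^+ 2 + (t * s) ^+ 2 =
  t ^+ 2 * (c ^+ 2 + s ^+ 2) - 2 * t * c + 1 by ring.
by rewrite cs; have := ler_wpM2l t0 ta; rewrite expr2; lra.
Qed.

Theorem theorem3p2 (R : realType) (H : hilbertType R)
    (H_separable : separable_space H)
    (H_nontrivial : exists x : H, x != 0)
    (T : bounded_operator H)
    (T_neq0 : exists x : H, T x != 0)
    (T_normal : normal_operator T)
    (phi0 delta : R)
    (delta_range : 0 <= delta < pi)
    (T_sector : forall lambda : R[i], spectrum T lambda ->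
      exists r phi : R,
        [/\ 0 <= r <= opnorm T, phi0 <= phi <= phi0 + delta
          & lambda = r%:C * cis phi])
    (alpha : R[i])
    (alpha_neq0 : alpha != 0)
    (alpha_arg : forall lambda : R[i], spectrum T lambda -> lambda != 0 ->
      in_mod2pi (Carg alpha + Carg lambda) (- (pi / 2)) (pi / 2))
    (alpha_norm : `|alpha| <=
      (2 / opnorm T * inf [set cos (Carg alpha + Carg lambda)
                          | lambda in spectrum T `\ 0])%:C) :
  A_class alpha T.
Proof.
have [//|nu1] := leP (opnorm (fun x => alpha *: T x - x)) 1.
rewrite /A_class /=.
have [lambda sl <-] :=
  affine_spectrum_attains_norm T alpha T_normal alpha_neq0 (lt_trans ltr01 nu1).
have [->|l0] := eqVneq lambda 0.
  by rewrite mulr0 sub0r /rnorm normrN normr1.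
have l_le : rnorm lambda <= opnorm T.
  have [r [phi [/andP[r0 rT] _ ->]]] := T_sector _ sl.
  by rewrite rnormM rnorm_cis mulr1 rnorm_real.
have lp : 0 < rnorm lambda by rewrite rnorm_gt0.
have Tp := lt_le_trans lp l_le.
set A := [set cos _ | _ in _] in alpha_norm.
have infA : inf A <= cos (Carg alpha + Carg lambda).
  apply: ge_inf; [by exists (-1) => _ [y _ <-]; exact: cos_geN1|].
  by exists lambda => //; split => //; exact/eqP.
rewrite rnormE lecR in alpha_norm.
have ap : 0 < rnorm alpha by rewrite rnorm_gt0.
have -> : alpha * lambda =
    (rnorm alpha * rnorm lambda)%:C * cis (Carg alpha + Carg lambda).
  by rewrite rmorphM /= -!rnormE cisD mulrACA -!CargP.
apply: rnorm_polar_sub1; rewrite mulr_ge0 ?rnorm_ge0//=.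
apply: (@le_trans _ _ (2 * inf A)); last by rewrite ler_wpM2l.
apply: le_trans (ler_wpM2l (ltW ap) l_le) _.
by rewrite -ler_pdivlMr// mulrAC.
Qed.
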